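(* Let $n,d\ge 1$ be integers. Every $((n,3,d))$ CWS code is a subcode (i.e. a linear subspace) of some $((n,4,d))$ stabilizer code.
   Context: All codes are subspaces of the $n$-qubit Hilbert space $(\mathbb{C}^2)^{\otimes n}$. The $n$-qubit Pauli group consists of the operators $\alpha\,e_1\otimes\cdots\otimes e_n$ with $\alpha\in\{\pm1,\pm i\}$ and $e_i\in\{I,X,Y,Z\}$; the weight of such an operator is the number of indices $i$ with $e_i\ne I$. CWS (codeword stabilized) code: let $S$ be an abelian subgroup of the $n$-qubit Pauli group with $|S|=2^n$ and $-I\notin S$, and let $|S\rangle$ be the (unique up to phase) unit vector with $s|S\rangle=|S\rangle$ for all $s\in S$ (a stabilizer state). Let $w_1,\dots,w_K$ be $n$-qubit Pauli operators (word operators) such that $w_1|S\rangle,\dots,w_K|S\rangle$ are mutually orthogonal. The CWS code is the $K$-dimensional span of $w_1|S\rangle,\dots,w_K|S\rangle$. (Up to local Clifford operations one may put a CWS code in standard form, where $|S\rangle$ is a graph state and $w_i=Z^{\mathbf{c}_i}$ with $\mathbf{c}_1=0$.) $((n,K,d))$ code: a $K$-dimensional subspace of $(\mathbb{C}^2)^{\otimes n}$, with orthogonal projector $P$, that detects all Pauli errors of weight less than $d$, i.e. for every Pauli operator $E$ of weight $<d$ there is a scalar $\lambda_E$ with $PEP=\lambda_E P$. Stabilizer code (= additive code): a nonzero subspace that is the joint $+1$ eigenspace of an abelian subgroup of the $n$-qubit Pauli group not containing $-I$. *)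

(* Defs.v *)
From mathcomp Require Import all_boot all_order all_algebra.
From mathcomp Require Import finmap.

Set Implicit Arguments.
Unset Strict Implicit.
Unset Printing Implicit Defensive.

Import Order.TTheory GRing.Theory Num.Theory.
Local Open Scope ring_scope.
Local Open Scope fset_scope.
Local Open Scope sesquilinear_scope.

(* The computational basis of the n-qubit space is indexed by n-bit strings,
   so the dimension is #|'I_2| ^ n, i.e. 2 ^ n. *)
Definition bitstring (n : nat) := {ffun 'I_n -> 'I_2}.
Definition qdim (n : nat) : nat := #|{: bitstring n}|.

Notation qvec C n := 'cV[C]_(qdim n).
Notation qop C n := 'M[C]_(qdim n).

(* e_1 (x) ... (x) e_n, with entries
   <x| e_1 (x) ... (x) e_n |y> = \prod_i <x_i| e_i |y_i>. *)
Definition tensor_op (C : numClosedFieldType) (n : nat)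
    (e : 'I_n -> 'M[C]_2) : qop C n :=
  \matrix_(x, y) \prod_(i < n)
     e i ((enum_val x : bitstring n) i) ((enum_val y : bitstring n) i).

Definition pauliX (C : numClosedFieldType) : 'M[C]_2 :=
  block_mx 0 1%:M
           1%:M 0 :> 'M_(1 + 1).

Definition pauliY (C : numClosedFieldType) : 'M[C]_2 :=
  block_mx 0 (- 'i)%:M
           'i%:M 0 :> 'M_(1 + 1).

Definition pauliZ (C : numClosedFieldType) : 'M[C]_2 :=
  block_mx 1%:M 0
           0 (-1)%:M :> 'M_(1 + 1).

Definition pauli_matrices (C : numClosedFieldType) : seq 'M[C]_2 :=
  [:: 1%:M; pauliX C; pauliY C; pauliZ C].

Definition pauli_phases (C : numClosedFieldType) : seq C :=
  [:: 1; -1; 'i; - 'i].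

Definition is_pauli_of_weight (C : numClosedFieldType) (n k : nat)
    (E : qop C n) : Prop :=
  exists (a : C) (e : 'I_n -> 'M[C]_2),
    [/\ a \in pauli_phases C,
        forall i, e i \in pauli_matrices C,
        E = a *: tensor_op e
      & #|[set i | e i != 1%:M]| = k].

Definition is_pauli (C : numClosedFieldType) (n : nat) (E : qop C n) : Prop :=
  exists k, is_pauli_of_weight k E.

(* Abelian subgroups of the Pauli group not containing -I. The Pauli group is
   finite, so taking S to be a finite set loses no generality. *)
Definition is_stabilizer_group (C : numClosedFieldType) (n : nat)
    (S : {fset qop C n}) : Prop :=
  [/\ forall s, s \in S -> is_pauli s,
      [/\ 1%:M \in S,
          forall s t, s \in S -> t \in S -> s *m t \in S
        & forall s, s \in S -> invmx s \in S],
      forall s t, s \in S -> t \in S -> s *m t = t *m s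
    & - 1%:M \notin S].

Definition stabilizes (C : numClosedFieldType) (n : nat)
    (S : {fset qop C n}) (v : qvec C n) : Prop :=
  forall s, s \in S -> s *m v = v.

Definition inner (C : numClosedFieldType) (n : nat) (u v : qvec C n) : C :=
  (u^t* *m v) 0 0.

Definition is_CWS_code (C : numClosedFieldType) (n K : nat)
    (Q : {vspace qvec C n}) : Prop :=
  exists (S : {fset qop C n}) (psi : qvec C n) (w : 'I_K -> qop C n),
    [/\ is_stabilizer_group S /\ #|` S| = (2 ^ n)%N,
        inner psi psi = 1 /\ stabilizes S psi,
        forall i, is_pauli (w i),
        forall i j, i != j -> inner (w i *m psi) (w j *m psi) = 0
      & Q = <<[seq w i *m psi | i : 'I_K]>>%VS].

Definition is_stabilizer_code (C : numClosedFieldType) (n : nat)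
    (Q : {vspace qvec C n}) : Prop :=
  Q != 0%VS /\
  exists S : {fset qop C n},
    is_stabilizer_group S /\ forall v, v \in Q <-> stabilizes S v.

Definition is_orthogonal_projector (C : numClosedFieldType) (n : nat)
    (P : qop C n) (Q : {vspace qvec C n}) : Prop :=
  [/\ P *m P = P, P^t* = P & forall v, v \in Q <-> P *m v = v].

(* Error detection is only demanded for weights k < d, degenerate (lambda <> 0)
   and nondegenerate errors alike. *)
Definition is_code (C : numClosedFieldType) (n K d : nat)
    (Q : {vspace qvec C n}) : Prop :=
  \dim Q = K /\
  exists2 P : qop C n, is_orthogonal_projector P Q &
    forall (k : nat) (E : qop C n), (k < d)%N -> is_pauli_of_weight k E ->
      exists lambda : C, P *m E *m P = lambda *: P.

(* Main.v *)
(* Absorb the first word operator into the stabilizer state; the code is then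
   spanned by phi, g phi and h phi for a stabilizer state phi (of a group S) and
   Pauli operators g, h. The stabilizer code is the span of the four orthonormal
   vectors W phi, W in {1, g, h, gh}; its stabilizer group T consists of the
   elements of S that commute with g and h. Indeed the sum over S of s is |S|
   times the projector on phi; conjugating by the four words W and adding up, the
   elements outside T cancel, so that the projector on the span is 4/|S| times the
   sum over T of t, which acts on the vectors fixed by T as a nonzero scalar.

   Up to a phase, W^* E W' = E W'' with W'' = W W', so the Knill-Laflamme
   conditions for the four words reduce to the values of <phi|E W|phi>. Those with
   W = 1, g, h are conditions of the given code, and W = gh is, up to a phase, the
   condition <g phi|E|h phi> = 0. As for the diagonal, if <phi|E|phi> = l <> 0
   then <g phi|E|g phi> = <h phi|E|h phi> = l forces E to commute with g and h,
   hence with gh. *)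
Require Import Defs.
From mathcomp Require Import all_boot all_order all_algebra.
From mathcomp Require Import finmap reals.
From mathcomp.real_closed Require Import complex.

Set Implicit Arguments.
Unset Strict Implicit.
Unset Printing Implicit Defensive.

Import Order.TTheory GRing.Theory Num.Theory.
Local Open Scope ring_scope.
Local Open Scope fset_scope.
Local Open Scope sesquilinear_scope.

(** * Conjugate transposes *)

Section Adjoint.

Context {C : numClosedFieldType}.

Lemma adjmxM m n p (A : 'M[C]_(m, n)) (B : 'M[C]_(n, p)) :
  (A *m B)^t* = B^t* *m A^t*.
Proof. by rewrite trmx_mul map_mxM. Qed.

Lemma adjmxZ m n (a : C) (A : 'M[C]_(m, n)) : (a *: A)^t* = a^* *: A^t*.
Proof. by rewrite linearZ /= map_mxZ. Qed.

Lemma adjmx1 n : (1%:M : 'M[C]_n)^t* = 1%:M.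
Proof. by rewrite trmx1 map_mx1. Qed.

(** The trace is the sum of the squared moduli of all entries of [A], and a vanishing sum of
    nonnegative terms has only zero terms. *)
Lemma trace_adjmx_mul_eq0 n (A : 'M[C]_n) : \tr (A^t* *m A) = 0 -> A = 0.
Proof.
rewrite /mxtrace => h.
have nn i j : 0 <= A^t* i j * A j i.
  by rewrite !mxE mulrC mul_conjC_ge0.
apply/matrixP=> i j; rewrite [RHS]mxE.
have {h}h : \sum_k \sum_l A^t* k l * A l k = 0.
  by rewrite -[RHS]h; apply: eq_bigr => k _; rewrite [RHS]mxE.
have h1 := psumr_eq0P (fun k _ => sumr_ge0 _ (fun l _ => nn k l)) h.
have /eqP := psumr_eq0P (fun l _ => nn j l) (h1 j isT) (i := i) isT.
by rewrite !mxE mulrC mul_conjC_eq0 => /eqP.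
Qed.

End Adjoint.

(** * The single-qubit Pauli matrices *)

Section SingleQubit.

Context {C : numClosedFieldType}.

Local Notation matrices := (pauli_matrices C).
Local Notation phases := (pauli_phases C).

Lemma pauli_phase1 : 1 \in phases.
Proof. exact: mem_head. Qed.

Lemma pauli_phaseM a b : a \in phases -> b \in phases -> a * b \in phases.
Proof.
rewrite !inE; do 2![case/or4P => /eqP->];
  by rewrite ?(mulrN, mulNr, mul1r, mulr1, opprK) -?expr2 ?sqrCi ?opprK
     ?eqxx ?orbT.
Qed.

Lemma pauli_phase_prod (I : finType) (a : I -> C) :
  (forall i, a i \in phases) -> \prod_i a i \in phases.
Proof.
by move=> ha; elim/big_ind: _ => //; [exact: pauli_phase1|exact: pauli_phaseM].
Qed.

Lemma pauli_phase_conj a : a \in phases -> a^* \in phases.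
Proof.
rewrite !inE; case/or4P => /eqP->;
  by rewrite ?rmorphN /= ?rmorph1 ?conjCi ?opprK ?eqxx ?orbT.
Qed.

Lemma pauli_phase_norm a : a \in phases -> a^* * a = 1.
Proof.
rewrite !inE; case/or4P => /eqP->;
  by rewrite ?rmorphN /= ?rmorph1 ?conjCi ?opprK ?(mulrN, mulNr) ?mulr1 -?expr2
     ?sqrCi ?opprK.
Qed.

Lemma pauli_phase_sqr a : a \in phases -> a * a = 1 \/ a * a = -1.
Proof.
rewrite !inE; case/or4P => /eqP->;
  by rewrite ?(mulrN, mulNr) ?mulr1 -?expr2 ?sqrCi ?opprK; (left + right).
Qed.

Variant pauli_matrices_spec : 'M[C]_2 -> Prop :=
| PauliI : pauli_matrices_spec 1%:M
| PauliX : pauli_matrices_spec (pauliX C)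
| PauliY : pauli_matrices_spec (pauliY C)
| PauliZ : pauli_matrices_spec (pauliZ C).

Lemma pauli_matricesP A : A \in matrices -> pauli_matrices_spec A.
Proof. by rewrite !inE; case/or4P => /eqP->; constructor. Qed.

Lemma pauli_mul1 :
  [/\ pauliX C *m pauliX C = 1%:M, pauliY C *m pauliY C = 1%:M &
      pauliZ C *m pauliZ C = 1%:M].
Proof.
have -> : 1%:M = block_mx 1%:M 0 0 1%:M :> 'M[C]_(1 + 1).
  by rewrite -scalar_mx_block.
split; rewrite /pauliX /pauliY /pauliZ (@mulmx_block _ 1 1 1 1 1 1)
  !(mul0mx, mulmx0, addr0, add0r, mul_scalar_mx, scale_scalar_mx)
  ?(mulrN, mulNr, mulr1, opprK) -?expr2 ?sqrCi ?opprK //.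
Qed.

Lemma pauli_mul :
  [/\ pauliX C *m pauliY C = 'i *: pauliZ C,
      pauliY C *m pauliZ C = 'i *: pauliX C &
      pauliZ C *m pauliX C = 'i *: pauliY C].
Proof.
split; rewrite /pauliX /pauliY /pauliZ (@mulmx_block _ 1 1 1 1 1 1)
  (@scale_block_mx _ 1 1 1 1) !(mul0mx, mulmx0, scaler0, addr0, add0r)
  !(mul_scalar_mx, scale_scalar_mx)
  ?(mulrN, mulNr, mulr1, mul1r, opprK) -?expr2 ?sqrCi ?opprK //.
Qed.

Lemma pauli_adj A : A \in matrices -> A^t* = A.
Proof.
case/pauli_matricesP; first exact: adjmx1;
rewrite /pauliX /pauliY /pauliZ (@tr_block_mx _ 1 1 1 1)
  (@map_block_mx _ _ _ 1 1 1 1) ?(trmx0, tr_scalar_mx, map_mx0, map_scalar_mx)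
  /= ?rmorphN /= ?rmorphN /= ?rmorph1 ?conjCi ?rmorphN /= ?opprK //.
Qed.

Lemma pauli_sqr1 A : A \in matrices -> A *m A = 1%:M.
Proof.
by move=> hA; case: pauli_mul1 => *; case/pauli_matricesP: hA => //; rewrite mul1mx.
Qed.

Lemma pauli_anti :
  [/\ pauliY C *m pauliX C = - ('i *: pauliZ C),
      pauliZ C *m pauliY C = - ('i *: pauliX C) &
      pauliX C *m pauliZ C = - ('i *: pauliY C)].
Proof.
split; rewrite /pauliX /pauliY /pauliZ (@mulmx_block _ 1 1 1 1 1 1)
  (@scale_block_mx _ 1 1 1 1) (@opp_block_mx _ 1 1 1 1)
  !(mul0mx, mulmx0, scaler0, oppr0, addr0, add0r)
  !(mul_scalar_mx, scale_scalar_mx) -?scaleN1r ?scale_scalar_mx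
  ?(mulrN, mulNr, mulr1, mul1r, opprK) -?expr2 ?sqrCi ?opprK //.
Qed.

(** Phase and matrix are packed into one pair so that a single application of [fin_all_exists] can
    choose them for all qubits at once. *)
Lemma pauli_mul_closed A B : A \in matrices -> B \in matrices ->
  exists cD : C * 'M[C]_2,
    [/\ cD.1 \in phases, cD.2 \in matrices & A *m B = cD.1 *: cD.2].
Proof.
have [m1 m2 m3] := pauli_mul; have [s1 s2 s3] := pauli_mul1.
have [t1 t2 t3] := pauli_anti.
have mem c D : c \in phases -> D \in matrices -> exists cD : C * 'M[C]_2,
    [/\ cD.1 \in phases, cD.2 \in matrices & c *: D = cD.1 *: cD.2].
  by move=> hc hD; exists (c, D).
have mem1 D : D \in matrices -> exists cD : C * 'M[C]_2,
    [/\ cD.1 \in phases, cD.2 \in matrices & D = cD.1 *: cD.2].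
  by move=> hD; exists (1, D); rewrite /= scale1r pauli_phase1.
case/pauli_matricesP => hB.
- by rewrite mul1mx; apply: mem1.
all: case/pauli_matricesP: hB;
  rewrite ?mulmx1 ?(m1, m2, m3, s1, s2, s3, t1, t2, t3) -?scaleNr;
  try by [apply: mem1; rewrite !inE eqxx ?orbT
         |apply: mem; rewrite !inE eqxx ?orbT].
Qed.

Lemma pauli_comm A B : A \in matrices -> B \in matrices ->
  exists2 c : C, c = 1 \/ c = -1 & A *m B = c *: (B *m A).
Proof.
have [m1 m2 m3] := pauli_mul; have [t1 t2 t3] := pauli_anti.
case/pauli_matricesP => hB.
- by exists 1; [left|rewrite mul1mx mulmx1 scale1r].
all: case/pauli_matricesP: hB;
  rewrite ?(m1, m2, m3, t1, t2, t3) -?scaleNr ?mul1mx ?mulmx1;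
  try by [exists 1; [left|rewrite scale1r]
         |exists (-1); [right|rewrite scalerA mulN1r ?opprK]].
Qed.

Lemma pauli_trace A : A \in matrices -> A != 1%:M -> \tr A = 0.
Proof.
case/pauli_matricesP; first by rewrite eqxx.
all: by rewrite /pauliX /pauliY /pauliZ (@mxtrace_block _ 1 1)
  ?mxtrace0 ?mxtrace_scalar ?addr0 ?subrr.
Qed.

End SingleQubit.

(** * Tensor products and the n-qubit Pauli group *)

Section Pauli.

Context {C : numClosedFieldType} {n : nat}.
Implicit Types (E F : qop C n) (e f : 'I_n -> 'M[C]_2).

(** Matrix indices are ordinals; passing to bit strings, which are functions, makes the
    distributivity of products over sums applicable. *)
Lemma sum_qdim (V : nmodType) (F : bitstring n -> V) :
  \sum_(z < qdim n) F (enum_val z) = \sum_s F s.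
Proof. by rewrite [RHS](reindex _ (onW_bij _ (@enum_val_bij _))). Qed.

Lemma tensor_opM e f :
  tensor_op e *m tensor_op f = tensor_op (fun i => e i *m f i).
Proof.
apply/matrixP=> x y; rewrite !mxE.
pose F (s : bitstring n) :=
  \prod_i (e i ((enum_val x : bitstring n) i) (s i)
           * f i (s i) ((enum_val y : bitstring n) i)).
transitivity (\sum_(z < qdim n) F (enum_val z)).
  by apply: eq_bigr => z _; rewrite !mxE -big_split.
(* Summing over all bit strings a product with one factor per qubit gives the product over the
   qubits of the sums over one bit. *)
rewrite sum_qdim /F -(bigA_distr_bigA (fun i j =>
  e i ((enum_val x : bitstring n) i) j * f i j ((enum_val y : bitstring n) i))).
by apply: eq_bigr => i _; rewrite mxE.
Qed.

Lemma tensor_opZ (c : 'I_n -> C) e :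
  tensor_op (fun i => c i *: e i) = (\prod_i c i) *: tensor_op e.
Proof.
apply/matrixP=> x y; rewrite !mxE -big_split.
by apply: eq_bigr => i _; rewrite !mxE.
Qed.

Lemma eq_tensor_op e f : e =1 f -> tensor_op e = tensor_op f.
Proof.
move=> ef; apply/matrixP=> x y; rewrite !mxE.
by apply: eq_bigr => i _; rewrite ef.
Qed.

Lemma tensor_op1 : tensor_op (fun=> 1%:M) = 1%:M :> qop C n.
Proof.
apply/matrixP=> x y; rewrite !mxE.
have [->|xy] := eqVneq x y; first by rewrite big1 // => i _; rewrite mxE eqxx.
have /existsP[i hi] : [exists i,
    (enum_val x : bitstring n) i != (enum_val y : bitstring n) i].
  apply: contraR xy => /existsPn h; apply/eqP/enum_val_inj/ffunP => i.
  by apply/eqP; have := h i; rewrite negbK.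
by rewrite (bigD1 i) //= mxE (negPf hi) mul0r.
Qed.

Lemma tensor_op_adj e : (tensor_op e)^t* = tensor_op (fun i => (e i)^t*).
Proof.
apply/matrixP=> x y; rewrite !mxE rmorph_prod.
by apply: eq_bigr => i _; rewrite !mxE.
Qed.

Lemma tensor_op_trace e : \tr (tensor_op e) = \prod_i \tr (e i).
Proof.
rewrite /mxtrace bigA_distr_bigA -sum_qdim.
by apply: eq_bigr => x _; rewrite mxE.
Qed.

Lemma is_pauliP E : is_pauli E <-> exists (a : C) e,
  [/\ a \in pauli_phases C, forall i, e i \in pauli_matrices C
    & E = a *: tensor_op e].
Proof.
split=> [[k [a [e [? ? ? _]]]]|[a [e [? ? ?]]]]; first by exists a, e.
by exists #|[set i | e i != 1%:M]|, a, e.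
Qed.

Lemma pauli1 : is_pauli (1%:M : qop C n).
Proof.
apply/is_pauliP; exists 1, (fun=> 1%:M); split; first exact: pauli_phase1.
  by move=> i; rewrite mem_head.
by rewrite tensor_op1 scale1r.
Qed.

Lemma pauliM E F : is_pauli E -> is_pauli F -> is_pauli (E *m F).
Proof.
move=> /is_pauliP[a [e [ha he ->]]] /is_pauliP[b [f [hb hf ->]]].
have [cD hcD] := fin_all_exists (fun i => pauli_mul_closed (he i) (hf i)).
apply/is_pauliP; exists (a * b * \prod_i (cD i).1), (fun i => (cD i).2); split.
- apply: pauli_phaseM; first exact: pauli_phaseM.
  by apply: pauli_phase_prod => i; case: (hcD i).
- by move=> i; case: (hcD i).
- rewrite -scalemxAl -scalemxAr tensor_opM -!scalerA -tensor_opZ.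
  by congr (_ *: (_ *: _)); apply: eq_tensor_op => i; case: (hcD i).
Qed.

Lemma pauli_adjm E : is_pauli E -> is_pauli (E^t*).
Proof.
move=> /is_pauliP[a [e [ha he ->]]]; apply/is_pauliP; exists (a^*), e.
split=> //; first exact: pauli_phase_conj.
rewrite adjmxZ tensor_op_adj; congr (_ *: _).
by apply: eq_tensor_op => i; rewrite pauli_adj.
Qed.

Lemma tensor_pauli_sqr e :
  (forall i, e i \in pauli_matrices C) -> tensor_op e *m tensor_op e = 1%:M.
Proof.
move=> he; rewrite tensor_opM -tensor_op1.
by apply: eq_tensor_op => i; rewrite pauli_sqr1.
Qed.

Lemma pauli_adjK E : is_pauli E -> E^t* *m E = 1%:M.
Proof.
move=> /is_pauliP[a [e [ha he ->]]].
rewrite adjmxZ tensor_op_adj -scalemxAl -scalemxAr scalerA pauli_phase_norm //.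
rewrite scale1r -(tensor_pauli_sqr he); congr (_ *m _).
by apply: eq_tensor_op => i; rewrite pauli_adj.
Qed.

Lemma pauli_Kadj E : is_pauli E -> E *m E^t* = 1%:M.
Proof. by move=> hE; apply: mulmx1C; apply: pauli_adjK. Qed.

Lemma pauli_sqr E : is_pauli E -> E *m E = 1%:M \/ E *m E = - 1%:M.
Proof.
move=> /is_pauliP[a [e [ha he ->]]].
rewrite -scalemxAl -scalemxAr scalerA tensor_pauli_sqr //.
by case: (pauli_phase_sqr ha) => ->; [left|right]; rewrite ?scale1r ?scaleN1r.
Qed.

Lemma pauli_commute E F : is_pauli E -> is_pauli F ->
  exists2 c : C, c = 1 \/ c = -1 & E *m F = c *: (F *m E).
Proof.
move=> /is_pauliP[a [e [ha he ->]]] /is_pauliP[b [f [hb hf ->]]].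
have [c hc hcE] := fin_all_exists2 (fun i => pauli_comm (he i) (hf i)).
exists (\prod_i c i).
  elim/big_ind: _ => //; first by left.
  by move=> x y [->|->] [->|->]; rewrite ?mulN1r ?mul1r ?opprK; (left + right).
rewrite -!scalemxAl -!scalemxAr !tensor_opM (eq_tensor_op hcE) tensor_opZ.
by rewrite !scalerA mulrC [a * b]mulrC mulrA.
Qed.

(** The trace of a tensor product is the product of the traces, so one factor other than the
    identity makes it vanish. *)
Lemma pauli_traceless E : is_pauli E ->
  \tr E = 0 \/ exists2 a : C, a \in pauli_phases C & E = a%:M.
Proof.
move=> /is_pauliP[a [e [ha he ->]]].
have [/forallP h|/forallPn[i hi]] := boolP [forall i, e i == 1%:M].
  right; exists a => //; rewrite -[RHS]scalemx1; congr (_ *: _).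
  by rewrite -tensor_op1; apply: eq_tensor_op => i; apply/eqP.
left; rewrite mxtraceZ tensor_op_trace (bigD1 i) //=.
by rewrite pauli_trace // mul0r mulr0.
Qed.

End Pauli.

(** * Stabilizer groups and stabilizer states *)

Section StabilizerGroup.

Context {C : numClosedFieldType} {n : nat}.
Implicit Types (S : {fset qop C n}) (s t w : qop C n) (psi : qvec C n).

Lemma stabilizer_sqr S s : is_stabilizer_group S -> s \in S -> s *m s = 1%:M.
Proof.
case=> hp [_ hM _] _ hN hs; case: (pauli_sqr (hp s hs)) => // hss.
by case/negP: hN; rewrite -hss hM.
Qed.

Lemma stabilizer_adj S s : is_stabilizer_group S -> s \in S -> s^t* = s.
Proof.
move=> hS hs; have hp : is_pauli s by case: hS => hp _ _ _; apply: hp.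
by rewrite -[LHS]mulmx1 -(stabilizer_sqr hS hs) mulmxA pauli_adjK ?mul1mx.
Qed.

(** A Pauli operator of nonzero trace is a scalar; in a stabilizer group it squares to the identity,
    so it is 1 or -1, and -1 is excluded. *)
Lemma stabilizer_traceless S s :
  is_stabilizer_group S -> s \in S -> s != 1%:M -> \tr s = 0.
Proof.
move=> hS hs; have [hp [_ hM _] _ hN] := hS.
case: (pauli_traceless (hp s hs)) => // -[a ha sa].
have haa : a * a = 1 \/ a * a = -1 := pauli_phase_sqr ha.
have := stabilizer_sqr hS hs; rewrite sa -scalar_mxM => hss.
case: haa hss => haa; rewrite haa => hss.
  have : (a - 1) * (a + 1) == 0 by rewrite -subr_sqr_1 expr2 haa subrr.
  rewrite mulf_eq0 subr_eq0 addr_eq0 => /orP[/eqP->|/eqP a1].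
    by rewrite eqxx.
  by case/negP: hN; rewrite -raddfN /= -a1 -sa.
by case/negP: hN; rewrite -raddfN /= hss; case: hS => _ [].
Qed.

(** Closure under inverses is automatic: a Pauli operator squares to 1 or -1, and since -1 is absent
    each element is its own inverse. *)
Lemma is_stabilizer_groupI S :
  (forall s, s \in S -> is_pauli s) -> 1%:M \in S ->
  (forall s t, s \in S -> t \in S -> s *m t \in S) ->
  (forall s t, s \in S -> t \in S -> s *m t = t *m s) ->
  - 1%:M \notin S -> is_stabilizer_group S.
Proof.
move=> hp h1 hM hC hN; split=> //; split=> // s hs.
case: (pauli_sqr (hp s hs)) => hss; last by case/negP: hN; rewrite -hss hM.
suff -> : invmx s = s by [].
have us : s \in unitmx by case/mulmx1_unit: hss.
by rewrite -[invmx s]mulmx1 -hss mulmxA mulVmx ?mul1mx.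
Qed.

(** If [S] stabilizes [psi], this group stabilizes [w *m psi]; it serves to absorb the first word
    operator into the state. *)
Definition conjugate_group w S : {fset qop C n} :=
  [fset w *m s *m w^t* | s in S].

Lemma pauli_conjM w s t : is_pauli w ->
  (w *m s *m w^t*) *m (w *m t *m w^t*) = w *m (s *m t) *m w^t*.
Proof.
by move=> hw; rewrite !mulmxA -[_ *m w^t* *m w]mulmxA pauli_adjK ?mulmx1.
Qed.

Lemma pauli_conjK w s : is_pauli w -> w^t* *m (w *m s *m w^t*) *m w = s.
Proof.
by move=> hw; rewrite !mulmxA pauli_adjK // mul1mx -mulmxA pauli_adjK ?mulmx1.
Qed.

Lemma pauli_conj_inj w : is_pauli w -> injective (fun s => w *m s *m w^t*).
Proof.
by move=> hw s t /(congr1 (fun x => w^t* *m x *m w)); rewrite !pauli_conjK.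
Qed.

Lemma conjugate_stabilizer_group w S : is_pauli w ->
  is_stabilizer_group S -> is_stabilizer_group (conjugate_group w S).
Proof.
move=> hw [hp [h1 hM _] hC hN]; apply: is_stabilizer_groupI.
- move=> _ /imfsetP[s /= hs ->]; apply: pauliM (pauli_adjm hw).
  exact: pauliM (hp s hs).
- by apply/imfsetP; exists 1%:M => //=; rewrite mulmx1 pauli_Kadj.
- move=> _ _ /imfsetP[s /= hs ->] /imfsetP[t /= ht ->]; rewrite pauli_conjM //.
  by apply/imfsetP; exists (s *m t) => //=; apply: hM.
- move=> _ _ /imfsetP[s /= hs ->] /imfsetP[t /= ht ->].
  by rewrite !pauli_conjM // (hC s t).
- apply/imfsetP=> -[s /= hs hE]; case/negP: hN.
  suff -> : - 1%:M = s by [].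
  apply: (pauli_conj_inj hw); rewrite -hE mulmxN mulNmx mulmx1 pauli_Kadj //.
Qed.

Lemma card_conjugate_group w S : is_pauli w ->
  #|` conjugate_group w S| = #|` S|.
Proof. by move=> hw; rewrite card_imfset //; apply: pauli_conj_inj. Qed.

Lemma conjugate_stabilizes w S psi : is_pauli w ->
  stabilizes S psi -> stabilizes (conjugate_group w S) (w *m psi).
Proof.
move=> hw hS _ /imfsetP[s /= hs ->].
by rewrite mulmxA -[_ *m w]mulmxA pauli_adjK // mulmx1 -mulmxA hS.
Qed.

Lemma inner_adj psi phi (A : qop C n) :
  inner (A *m psi) phi = inner psi (A^t* *m phi).
Proof. by rewrite /inner adjmxM mulmxA. Qed.

(** Left multiplication by [s] is an involution, so it permutes the group. *)
Lemma mul_stabilizer_sum S s : is_stabilizer_group S -> s \in S ->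
  s *m (\sum_(t <- S) t) = \sum_(t <- S) t.
Proof.
move=> hS hs; have [hp [_ hM _] _ _] := hS; pose f t : qop C n := s *m t.
rewrite mulmx_sumr -[LHS](big_map f predT id).
apply: perm_big; have inj : injective f.
  by apply: (@can_inj _ _ f f) => t; rewrite /f mulmxA (stabilizer_sqr hS) ?mul1mx.
apply: uniq_perm; rewrite ?map_inj_uniq ?fset_uniq // => t.
apply/mapP/idP => [[u hu ->]|ht]; first exact: hM.
by exists (s *m t); rewrite ?hM // /f mulmxA (stabilizer_sqr hS) ?mul1mx.
Qed.

Lemma mxtrace_stabilizer_sum S : is_stabilizer_group S ->
  \tr (\sum_(s <- S) s) = (2 ^ n)%:R.
Proof.
move=> hS; have [_ [h1 _ _] _ _] := hS.
rewrite raddf_sum (bigD1_seq 1%:M) ?fset_uniq //= big_seq_cond big1 ?addr0.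
  by rewrite mxtrace1 /qdim card_ffun !card_ord.
by move=> s /andP[hs s1]; apply: (stabilizer_traceless hS).
Qed.

(* If [psi] is a stabilizer state, then [\sum_(s in S) s] minus [#|S|] times the
   projector on [psi] is self-adjoint, of trace zero, and proportional to its
   square, hence zero. *)
Lemma stabilizer_sumE S psi : is_stabilizer_group S -> #|` S| = (2 ^ n)%N ->
  inner psi psi = 1 -> stabilizes S psi ->
  \sum_(s <- S) s = (2 ^ n)%:R *: (psi *m psi^t*).
Proof.
move=> hS cS hpsi hst; set N : C := (2 ^ n)%:R.
set A := \sum_(s <- S) s; set Q := psi *m psi^t*.
have NR : N^* = N by rewrite /N rmorph_nat.
have N0 : N != 0 by rewrite /N pnatr_eq0 expn_eq0.
have psi1 : psi^t* *m psi = 1%:M.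
  by apply/matrixP=> i j; rewrite !ord1 !mxE -[RHS]hpsi /inner mxE.
have sizeS : (\sum_(s <- S) 1 : C) = N.
  by rewrite big_const_seq count_predT iter_addr_0 /N -cS.
have AA : A *m A = N *: A.
  rewrite {1}/A mulmx_suml -sizeS scaler_suml; apply: eq_big_seq => s hs.
  by rewrite mul_stabilizer_sum // scale1r.
have Aadj : A^t* = A.
  rewrite /A linear_sum /= map_mx_sum; apply: eq_big_seq => s hs.
  exact: stabilizer_adj hS hs.
have Qadj : Q^t* = Q by rewrite adjmxM trmxCK.
have AQ : A *m Q = N *: Q.
  rewrite /A mulmx_suml -sizeS scaler_suml; apply: eq_big_seq => s hs.
  by rewrite mulmxA hst // scale1r.
have QA : Q *m A = N *: Q by rewrite -Aadj -Qadj -adjmxM AQ adjmxZ NR.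
have QQ : Q *m Q = Q by rewrite /Q mulmxA -[psi *m _ *m psi]mulmxA psi1 mulmx1.
apply/eqP; rewrite -subr_eq0; apply/eqP/trace_adjmx_mul_eq0.
have -> : (A - N *: Q)^t* = A - N *: Q.
  by rewrite linearB /= map_mxB Aadj adjmxZ Qadj NR.
have -> : (A - N *: Q) *m (A - N *: Q) = N *: (A - N *: Q).
  rewrite mulmxBl !mulmxBr AA -!scalemxAl -!scalemxAr AQ QA QQ subrr subr0.
  by rewrite scalerBr.
rewrite mxtraceZ raddfB /= mxtraceZ mxtrace_stabilizer_sum // mxtrace_mulC psi1.
by rewrite mxtrace1 mulr1 subrr mulr0.
Qed.

End StabilizerGroup.

(** * Codes spanned by orthonormal families *)

Section OrthonormalCode.

Context {C : numClosedFieldType} {n : nat} {I : finType}.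
Context (u : I -> qvec C n).

Lemma innerE (v w : qvec C n) : v^t* *m w = (inner v w)%:M.
Proof. by rewrite [LHS]mx11_scalar. Qed.

Lemma inner_sumr (J : Type) (r : seq J) (c : J -> C) (v : qvec C n) w :
  inner v (\sum_(j <- r) c j *: w j) = \sum_(j <- r) c j * inner v (w j).
Proof.
rewrite /inner mulmx_sumr summxE; apply: eq_bigr => j _.
by rewrite -scalemxAr mxE.
Qed.

(** For an orthonormal family this is the orthogonal projector on its span. *)
Definition frame_op : qop C n := \sum_i u i *m (u i)^t*.

Lemma frame_opE v : frame_op *m v = \sum_i inner (u i) v *: u i.
Proof.
rewrite mulmx_suml; apply: eq_bigr => i _.
by rewrite -mulmxA innerE mul_mx_scalar.
Qed.

Lemma frame_op_span v : frame_op *m v \in <<[seq u i | i : I]>>%VS.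
Proof.
rewrite frame_opE; apply: memv_suml => i _; apply/memvZ/memv_span.
by apply/imageP; exists i.
Qed.

Context (orth : forall i j, inner (u i) (u j) = (i == j)%:R).

Lemma frame_op_fix j : frame_op *m u j = u j.
Proof.
rewrite frame_opE (bigD1 j) //= orth eqxx scale1r big1 ?addr0 // => i ij.
by rewrite orth (negPf ij) scale0r.
Qed.

Lemma frame_op_projector :
  is_orthogonal_projector frame_op <<[seq u i | i : I]>>%VS.
Proof.
split.
- rewrite {2}/frame_op mulmx_sumr; apply: eq_bigr => i _.
  by rewrite mulmxA frame_op_fix.
- rewrite /frame_op linear_sum /= map_mx_sum; apply: eq_bigr => i _.
  by rewrite adjmxM trmxCK.
- move=> v; split=> [|<-]; last exact: frame_op_span.
  move=> /(@coord_span _ _ _ (in_tuple _)) ->.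
  rewrite mulmx_sumr; apply: eq_bigr => i _; rewrite -scalemxAr; congr (_ *: _).
  have /imageP[j _ ->] := mem_nth 0 (ltn_ord i).
  exact: frame_op_fix.
Qed.

Lemma dim_orthonormal : \dim <<[seq u i | i : I]>>%VS = #|I|.
Proof.
have /eqnP -> : free [seq u i | i : I]; last by rewrite size_map -cardE.
apply/(@freeP _ _ _ (in_tuple _)) => k hk i.
have szI : size [seq u i | i : I] = size (enum I) by rewrite size_map.
(* Freeness speaks of positions in a list, orthonormality of elements of [I]. The element at a
   position is given for every default value, so that two positions can be compared under one
   default. *)
have hi (j : 'I_(size [seq u i | i : I])) :
    exists2 a, (in_tuple [seq u i | i : I])`_j = u a
      & forall i0, nth i0 (enum I) j = a.
  have jI : (j < size (enum I))%N by rewrite -szI; apply: ltn_ord.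
  have a0 : I by case: (enum I) jI => // a.
  exists (nth a0 (enum I) j) => [|i0]; first by rewrite /= (nth_map a0).
  exact: set_nth_default.
have [a ua na] := hi i.
(* Pairing the vanishing combination with [u a] isolates the coefficient at position [i]. *)
have := congr1 (inner (u a)) hk; rewrite inner_sumr (bigD1 i) //= ua.
rewrite orth eqxx mulr1.
rewrite big1 => [|j ji].
  by rewrite addr0 => ->; rewrite /inner mulmx0 mxE.
have [b ub nb] := hi j; rewrite /= in ub; rewrite ub orth.
case: eqVneq => [ab|]; last by rewrite mulr0.
case/eqP: ji; apply/val_inj/eqP.
rewrite -(nth_uniq a _ _ (enum_uniq I)) -?szI //; last exact: (ltn_ord i).
  by rewrite nb na ab.
exact: (ltn_ord j).
Qed.

(** With [P] the frame operator, [P E u_j] is the sum over [i] of [<u_i|E|u_j> u_i], which the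
    condition turns into [lambda u_j]. *)
Lemma orthonormal_is_code d :
  (forall k (E : qop C n), (k < d)%N -> is_pauli_of_weight k E ->
     exists lambda, forall i j, inner (u i) (E *m u j) = lambda * (i == j)%:R) ->
  is_code #|I| d <<[seq u i | i : I]>>%VS.
Proof.
move=> hE; split; first exact: dim_orthonormal.
exists frame_op; first exact: frame_op_projector.
move=> k E kd wE; have [l hl] := hE k E kd wE; exists l.
rewrite {2}/frame_op mulmx_sumr scaler_sumr; apply: eq_bigr => j _.
rewrite mulmxA -[frame_op *m E *m _]mulmxA frame_opE (bigD1 j) //= big1.
  by rewrite hl eqxx mulr1 addr0 scalemxAl.
by move=> i ij; rewrite hl (negPf ij) mulr0 scale0r.
Qed.

(** The projector is self-adjoint and fixes every [u i], so [E] may be replaced by [P E P] between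
    two of these vectors. *)
Lemma code_inner K d k (E : qop C n) : is_code K d <<[seq u i | i : I]>>%VS ->
  (k < d)%N -> is_pauli_of_weight k E ->
  exists lambda, forall i j, inner (u i) (E *m u j) = lambda * (i == j)%:R.
Proof.
case=> _ [P [PP Padj hP] hdet] kd wE.
have [l hl] := hdet k E kd wE; exists l => i j.
have Pu a : P *m u a = u a by apply/hP/memv_span/imageP; exists a.
rewrite -[in LHS](Pu i) -[in LHS](Pu j) inner_adj Padj !mulmxA hl -scalemxAl Pu.
by rewrite -orth /inner -scalemxAr mxE.
Qed.

End OrthonormalCode.

(** * The four words: error detection and conjugation sums *)

Section FourWords.

Context {C : numClosedFieldType} {n : nat}.
Implicit Types (E s : qop C n) (psi : qvec C n) (x y : bool * bool).

Lemma pauli_adj_sign E : is_pauli E -> exists c : C, E = c *: E^t*.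
Proof.
move=> hE; have EK : E = E *m E *m E^t* by rewrite -mulmxA pauli_Kadj ?mulmx1.
case: (pauli_sqr hE) => EE; [exists 1|exists (-1)]; rewrite {1}EK EE.
  by rewrite mul1mx scale1r.
by rewrite mulNmx mul1mx scaleN1r.
Qed.

Context (g h : qop C n).
Context (pg : is_pauli g) (ph : is_pauli h).

(** The booleans are exponents of [g] and [h]; modulo scalars, [word] is a homomorphism from the
    Klein four-group. *)
Definition word x : qop C n :=
  (if x.1 then g else 1%:M) *m (if x.2 then h else 1%:M).

Lemma pauli_word x : is_pauli (word x).
Proof. by case: x => -[] []; apply: pauliM => //; apply: pauli1. Qed.

Lemma wordM x y : exists c : C,
  word x *m word y = c *: word (x.1 (+) y.1, x.2 (+) y.2).
Proof.
have [a ga] : exists a : C, g *m g = a *: 1%:M.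
  by case: (pauli_sqr pg) => ->; [exists 1|exists (-1)]; rewrite ?scale1r ?scaleN1r.
have [b hb] : exists b : C, h *m h = b *: 1%:M.
  by case: (pauli_sqr ph) => ->; [exists 1|exists (-1)]; rewrite ?scale1r ?scaleN1r.
have [c _ hg] := pauli_commute ph pg.
have gK A : g *m (g *m A) = a *: A by rewrite mulmxA ga -scalemxAl mul1mx.
have hgA A : h *m (g *m A) = c *: (g *m (h *m A)).
  by rewrite mulmxA hg -scalemxAl mulmxA.
have eq1 (A : qop C n) : exists c : C, A = c *: A by exists 1; rewrite scale1r.
have hK A : h *m (h *m A) = b *: A by rewrite mulmxA hb -scalemxAl mul1mx.
case: x y => [[] []] [[] []] /=; rewrite /word /= ?mulmx1 ?mul1mx -?mulmxA;
 rewrite ?(hgA, hg) -?scalemxAr ?(gK, hK, ga, hb) -?scalemxAr ?(gK, ga) ?scalerA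
   ?mulmx1.
all: by [exact: eq1 | exact: (ex_intro _ _ erefl)].
Qed.

(** The condition [c * l = l] means that [c] is 1 unless [l] is 0. It is preserved by products of
    scalars, so it passes from [g] and [h] to [gh] without a case distinction on [l]. *)
Lemma word_comm_sign E (l : C) x :
  (forall y, (y == (true, false)) || (y == (false, true)) ->
     exists2 c : C, E *m word y = c *: (word y *m E) & c * l = l) ->
  exists2 c : C, E *m word x = c *: (word x *m E) & c * l = l.
Proof.
move=> H; have [a ha al] := H (true, false) isT.
have [b hb bl] := H (false, true) isT.
move: ha hb; rewrite /word /= mulmx1 mul1mx => ha hb.
case: x => [[] []] /=; rewrite ?mul1mx ?mulmx1.
- exists (a * b); last by rewrite -mulrA bl.
  by rewrite mulmxA ha -scalemxAl -mulmxA hb -scalemxAr scalerA mulmxA.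
- by exists a.
- by exists b.
- by exists 1; rewrite ?mul1r ?scale1r ?mulmx1 ?mul1mx.
Qed.

Lemma word_detect psi E (l : C) : is_pauli E ->
  inner psi (E *m psi) = l ->
  inner (g *m psi) (E *m (g *m psi)) = l ->
  inner (h *m psi) (E *m (h *m psi)) = l ->
  inner psi (E *m (g *m psi)) = 0 ->
  inner psi (E *m (h *m psi)) = 0 ->
  inner (g *m psi) (E *m (h *m psi)) = 0 ->
  forall x y, inner (word x *m psi) (E *m (word y *m psi)) = l * (x == y)%:R.
Proof.
move=> pE h00 h11 h22 h01 h02 h12.
have innerZ (c : C) (v w : qvec C n) : inner v (c *: w) = c * inner v w.
  by rewrite /inner -scalemxAr mxE.
(* Moving [F] to the left of [E] and cancelling it against its adjoint turns the value into [c * l];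
   by assumption it is also [l]. *)
have sgn F : is_pauli F -> inner (F *m psi) (E *m (F *m psi)) = l ->
    exists2 c : C, E *m F = c *: (F *m E) & c * l = l.
  move=> pF hF; have [c _ hc] := pauli_commute pE pF; exists c => //.
  rewrite -[RHS]hF inner_adj (mulmxA E) hc -scalemxAl -scalemxAr innerZ.
  by rewrite !mulmxA pauli_adjK // mul1mx h00.
have off z : z != (false, false) -> inner psi (E *m (word z *m psi)) = 0.
  case: z => [[] []] //= _; rewrite /word /= ?mulmx1 ?mul1mx //.
  (* Only [gh] remains: move [g] past [E] and replace it by a multiple of its adjoint, which gives a
     multiple of [<g psi|E|h psi>]. *)
  have [c hc] := pauli_adj_sign pg; have [a _ ha] := pauli_commute pE pg.
  rewrite !mulmxA ha -!scalemxAl innerZ {1}hc -!scalemxAl innerZ.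
  rewrite -!mulmxA -inner_adj h12.
  by rewrite !mulr0.
move=> x y; rewrite inner_adj.
have [<-|xy] := eqVneq x y.
  have [|c hc cl] := @word_comm_sign E l x.
    move=> z; rewrite /word => /orP[/eqP->|/eqP->] /=; rewrite ?mulmx1 ?mul1mx;
      exact: sgn.
  rewrite mulr1 (mulmxA E) hc -scalemxAl -scalemxAr innerZ -(mulmxA (word x)).
  by rewrite (mulmxA ((word x)^t*)) pauli_adjK ?mul1mx ?h00 //; apply: pauli_word.
(* Off the diagonal, the adjoint of [word x] is a multiple of [word x]; moved past [E] it merges
   with [word y] into a word with exponents other than (false, false). *)
have [c hc] := pauli_adj_sign (pauli_adjm (pauli_word x)); rewrite trmxCK in hc.
have [b _ hb] := pauli_commute (pauli_word x) pE.
have [a ha] := wordM x y.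
rewrite mulr0 hc -scalemxAl innerZ mulmxA hb -scalemxAl innerZ -(mulmxA E).
rewrite (mulmxA (word x)) ha -scalemxAl -scalemxAr innerZ off ?mulr0 //.
by apply: contra_neq xy; case: x y {hc hb ha} => [[] []] [[] []].
Qed.

Definition commutes_with_words s := (s *m g == g *m s) && (s *m h == h *m s).

Lemma pauli_conj_sign s F : is_pauli s -> is_pauli F ->
  F *m s *m F^t* = (if s *m F == F *m s then s else - s).
Proof.
move=> ps pF; case: eqP => [<-|sF]; first by rewrite -mulmxA pauli_Kadj ?mulmx1.
have [c [->|->] hc] := pauli_commute pF ps; first by rewrite hc scale1r in sF.
by rewrite hc scaleN1r mulNmx -mulmxA pauli_Kadj ?mulmx1.
Qed.

(** If [a] and [b] are the commutation signs of [s] with [g] and [h], the four conjugates add up to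
    [(1 + a)(1 + b) s]. *)
Lemma sum_word_conj s : is_pauli s ->
  \sum_x word x *m s *m (word x)^t*
    = (if commutes_with_words s then 4%:R else 0) *: s.
Proof.
move=> ps.
rewrite -(pair_bigA _ (fun a b => word (a, b) *m s *m (word (a, b))^t*)) /=.
rewrite !big_bool /word /= !mulmx1 !mul1mx !adjmxM adjmx1 !mulmx1.
have -> : g *m h *m s *m (h^t* *m g^t*) = g *m (h *m s *m h^t*) *m g^t*.
  by rewrite !mulmxA.
rewrite (pauli_conj_sign ps ph) (pauli_conj_sign ps pg) /commutes_with_words.
case: (s *m h == _); rewrite ?mulmxN ?mulNmx (pauli_conj_sign ps pg) andbC /=;
  case: (s *m g == _); rewrite ?opprK ?scale0r ?addrA ?subrr ?add0r ?addrK
    ?subrK ?addNr //.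
by rewrite scaler_nat !mulrSr mulr0n add0r.
Qed.

End FourWords.

(** * The span of the four words as a stabilizer code *)

Section WordsStabilizer.

Context {C : numClosedFieldType} {n : nat}.
Implicit Types (S : {fset qop C n}) (psi : qvec C n) (g h : qop C n).

Definition commuting_subgroup S g h : {fset qop C n} :=
  [fset s in S | commutes_with_words g h s].

Lemma commuting_subgroupE S g h s : (s \in commuting_subgroup S g h)
  = [&& s \in S, s *m g == g *m s & s *m h == h *m s].
Proof. by rewrite !inE /=. Qed.

Lemma commuting_subgroup_stabilizer S g h :
  is_stabilizer_group S -> is_stabilizer_group (commuting_subgroup S g h).
Proof.
case=> hp [h1 hM _] hC hN; apply: is_stabilizer_groupI.
- by move=> s; rewrite commuting_subgroupE => /andP[sS _]; apply: hp.
- by rewrite commuting_subgroupE h1 !mulmx1 !mul1mx !eqxx.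
- move=> s t; rewrite !commuting_subgroupE.
  move=> /and3P[sS /eqP sg /eqP sh] /and3P[tS /eqP tg /eqP th].
  by rewrite hM //= -!mulmxA tg th !mulmxA sg sh !eqxx.
- by move=> s t; rewrite !commuting_subgroupE => /andP[sS _] /andP[tS _]; apply: hC.
- by rewrite commuting_subgroupE (negPf hN).
Qed.

Context (S : {fset qop C n}) (psi : qvec C n) (g h : qop C n).
Context (hS : is_stabilizer_group S) (cS : #|` S| = (2 ^ n)%N).
Context (psi1 : inner psi psi = 1) (hpsi : stabilizes S psi).
Context (pg : is_pauli g) (ph : is_pauli h).

Local Notation T := (commuting_subgroup S g h).
Local Notation words := (fun x => word g h x *m psi).

Lemma words_frame_op :
  (2 ^ n)%:R *: frame_op words = 4%:R *: \sum_(s <- T) s.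
Proof.
have hp : forall s, s \in S -> is_pauli s by case: hS.
(* This sum is computed twice: from the rank-one form of the inner sum, and term by term after
   exchanging the two sums. *)
transitivity (\sum_x word g h x *m (\sum_(s <- S) s) *m (word g h x)^t*).
  rewrite (stabilizer_sumE hS cS psi1 hpsi) scaler_sumr; apply: eq_bigr => x _.
  by rewrite adjmxM -scalemxAr -scalemxAl !mulmxA.
under eq_bigr => x _ do rewrite mulmx_sumr mulmx_suml.
rewrite exchange_big /= big_seq.
under eq_bigr => s sS do rewrite (sum_word_conj pg ph (hp s sS)).
rewrite -big_seq scaler_sumr -[in RHS]big_fset_condE [RHS]big_mkcond /=.
by apply: eq_bigr => s _; case: ifP => _; rewrite ?scale0r.
Qed.

Lemma words_stabilized v :
  v \in <<[seq words x | x : bool * bool]>>%VS <-> stabilizes T v.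
Proof.
split=> [/(@coord_span _ _ _ (in_tuple _)) -> s|hv].
  rewrite commuting_subgroupE => /and3P[sS /eqP sg /eqP sh].
  rewrite mulmx_sumr; apply: eq_bigr => i _; rewrite -scalemxAr; congr (_ *: _).
  have /imageP[x _ ->] := mem_nth 0 (ltn_ord i).
  (* An element of [T] commutes with every word, so it can be moved onto [psi], which it fixes. *)
  have sw : s *m word g h x = word g h x *m s.
    rewrite /word; case: x => [[] []]; rewrite /= ?mulmx1 ?mul1mx //.
    by rewrite mulmxA sg -mulmxA sh mulmxA.
  by rewrite mulmxA sw -(mulmxA (word g h x)) (hpsi sS).
have T1 : 1%:M \in T.
  by rewrite commuting_subgroupE !mulmx1 !mul1mx !eqxx; case: hS => _ [->] //.
have T0 : 4%:R * (#|` T|)%:R != 0 :> C.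
  rewrite -natrM pnatr_eq0 muln_eq0 /= cardfs_eq0.
  by apply/eqP => TE; rewrite TE inE in T1.
have : (2 ^ n)%:R *: (frame_op words *m v) = (4%:R * (#|` T|)%:R) *: v.
  rewrite scalemxAl words_frame_op -scalemxAl mulmx_suml -scalerA; congr (_ *: _).
  transitivity (\sum_(t <- T) v).
    by apply: eq_big_seq => t tT; rewrite hv.
  by rewrite big_const_seq count_predT iter_addr_0 scaler_nat.
(* Dividing by the nonzero scalar writes [v] as a multiple of its image under the frame operator,
   which lies in the span. *)
move=> /(congr1 ( *:%R (4%:R * (#|` T|)%:R)^-1)); rewrite scalerA [in RHS]scalerA.
by rewrite mulVf // scale1r => <-; apply/memvZ/frame_op_span.
Qed.

End WordsStabilizer.

(** * Extending three words to four *)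

Lemma CWS_code3_extension (C : numClosedFieldType) (n d : nat)
    (Q : {vspace qvec C n}) :
  is_CWS_code 3 Q -> is_code 3 d Q ->
  exists Q' : {vspace qvec C n},
    [/\ is_stabilizer_code Q', is_code 4 d Q' & (Q <= Q')%VS].
Proof.
case=> S [psi [w [[hS cS] [psi1 hpsi] pw worth ->]]] hQ.
pose i0 : 'I_3 := inord 0; pose i1 : 'I_3 := inord 1; pose i2 : 'I_3 := inord 2.
have [i01 i02 i12] : [/\ i0 != i1, i0 != i2 & i1 != i2].
  by split; apply/eqP => /(congr1 val); rewrite /= !inordK.
pose u i := w i *m psi; pose phi := u i0.
have uorth i j : inner (u i) (u j) = (i == j)%:R.
  have [<-|] := eqVneq i j; last exact: worth.
  by rewrite inner_adj mulmxA pauli_adjK ?mul1mx.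
(* As [w i0] is unitary, [g] and [h] carry [phi] to the second and third basis vectors of the
   code. *)
pose g := w i1 *m (w i0)^t*; pose h := w i2 *m (w i0)^t*.
have pg : is_pauli g by apply/pauliM/pauli_adjm.
have ph : is_pauli h by apply/pauliM/pauli_adjm.
have gphi : g *m phi = u i1.
  by rewrite mulmxA -(mulmxA (w i1)) pauli_adjK ?mulmx1.
have hphi : h *m phi = u i2.
  by rewrite mulmxA -(mulmxA (w i2)) pauli_adjK ?mulmx1.
pose v x := word g h x *m phi.
have detect E l : is_pauli E ->
    (forall i j, inner (u i) (E *m u j) = l * (i == j)%:R) ->
    forall x y, inner (v x) (E *m v y) = l * (x == y)%:R.
  move=> pE hE x y; apply: word_detect => //; rewrite ?gphi ?hphi hE ?eqxx ?mulr1 //.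
  - by rewrite (negPf i01) mulr0.
  - by rewrite (negPf i02) mulr0.
  - by rewrite (negPf i12) mulr0.
(* Orthonormality of the four vectors is the case of the identity error with [l = 1]. *)
have vorth x y : inner (v x) (v y) = (x == y)%:R.
  have u1 i j : inner (u i) (1%:M *m u j) = 1 * (i == j)%:R.
    by rewrite mul1mx mul1r.
  by have := detect _ _ pauli1 u1 x y; rewrite mul1mx mul1r.
exists <<[seq v x | x : bool * bool]>>%VS; split.
- split.
    rewrite -dimv_eq0 (dim_orthonormal vorth) card_prod card_bool //.
  exists (commuting_subgroup (conjugate_group (w i0) S) g h); split.
    by apply/commuting_subgroup_stabilizer/conjugate_stabilizer_group.
  apply: words_stabilized => //.
  + exact: conjugate_stabilizer_group.
  + by rewrite card_conjugate_group.
  + by rewrite -/phi uorth eqxx.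
  + exact: conjugate_stabilizes.
- have -> : 4%N = #|{: bool * bool}| by rewrite card_prod card_bool.
  apply: orthonormal_is_code => // k E kd wE.
  have [l hl] := code_inner uorth hQ kd wE; exists l.
  by apply: detect => //; exists k.
- apply/span_subvP => _ /imageP[i _ ->].
  have [x ux] : exists x, u i = v x.
    have /or3P[] : [|| i == i0, i == i1 | i == i2].
      by case: i => [[|[|[|]]] hi] //; rewrite -!val_eqE /= !inordK.
    + by move/eqP->; exists (false, false); rewrite /v /word /= !mul1mx.
    + by move/eqP->; exists (true, false); rewrite /v /word /= mulmx1 gphi.
    + by move/eqP->; exists (false, true); rewrite /v /word /= mul1mx hphi.
  by rewrite -/(u i) ux; apply/memv_span/imageP; exists x.
Qed.

Local Open Scope complex_scope.

Theorem theorem7 (R : realType) (n d : nat) (Q : {vspace qvec R[i] n}) :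
  (1 <= n)%N -> (1 <= d)%N ->
  is_CWS_code 3 Q -> is_code 3 d Q ->
  exists Q' : {vspace qvec R[i] n},
    [/\ is_stabilizer_code Q', is_code 4 d Q' & (Q <= Q')%VS].
Proof. by move=> _ _; apply: CWS_code3_extension. Qed.
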